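(* Let $G$ be a connected weighted graph of order $n\ge 3$. Then $$K(G)\ \ge\ \frac{1}{2\phi(G)}+\frac{(n-2)^2}{n},$$ and equality cannot occur.
   Context: Graphs are finite, simple, connected, undirected and weighted: $G=(V,E,c)$ with symmetric weights $c(i,j)=c_{ij}=c_{ji}>0$ if $\{i,j\}\in E$ and $c_{ij}=0$ otherwise (no loops), $|V|=n$. The degree of vertex $i$ is $k_i=\sum_j c_{ij}$, $D=\operatorname{diag}(k_1,\dots,k_n)$, $A=(c_{ij})$ is the adjacency matrix. For $S\subseteq V$, $\operatorname{vol}(S)=\sum_{i\in S}k_i$ and $\bar S=V\setminus S$. The conductance of $G$ is $$\phi(G)=\min_{\emptyset\ne S\subsetneq V}\frac{\sum_{u\in S,v\in\bar S}c_{uv}}{\min(\operatorname{vol}(S),\operatorname{vol}(\bar S))}.$$ The normalized adjacency matrix is $M_G=D^{-1/2}AD^{-1/2}$, with eigenvalues $1=\lambda_1>\lambda_2\ge\cdots\ge\lambda_n\ge-1$. Kemeny's constant is $K(G)=\sum_i\pi_i m_{ji}-1$ for the random walk with transition matrix $D^{-1}A$, where $\pi$ is the stationary distribution and $m_{ji}$ the mean first passage time from $j$ to $i$ (with $m_{jj}$ the mean first return time); this does not depend on $j$, and it is known that $K(G)=\sum_{j=2}^{n}\frac{1}{1-\lambda_j}$. *)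

(* Defs.v *)
From HB Require Import structures.
From mathcomp Require Import all_boot all_order all_algebra.
From mathcomp Require Import all_classical all_reals all_analysis.
Set Implicit Arguments.
Unset Strict Implicit.
Unset Printing Implicit Defensive.
Import Order.TTheory GRing.Theory Num.Theory.
Local Open Scope classical_set_scope.
Local Open Scope ring_scope.

(* The edge set is the support of the weight function. *)
Record wgraph (R : realType) (V : finType) := WGraph {
  weight :> V -> V -> R;
  weight_sym : forall i j, weight i j = weight j i;
  weight_ge0 : forall i j, 0 <= weight i j;
  weight_loopless : forall i, weight i i = 0
}.

Section WeightedGraph.
Context (R : realType) (V : finType).
Implicit Types (G : wgraph R V) (S : {set V}).

Definition edge G : rel V := [rel i j | 0 < G i j].

Definition connected_graph G := forall i j, connect (edge G) i j.

Definition degree G i : R := \sum_j G i j.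

Definition vol G S : R := \sum_(i in S) degree G i.

Definition cut_weight G S : R := \sum_(u in S) \sum_(v in ~: S) G u v.

(* The set below is finite, and it is nonempty when #|V| >= 2, so that the
   infimum is then a minimum. *)
Definition conductance G : R :=
  inf [set r | exists S : {set V},
    [/\ S != finset.set0, S \proper finset.setT &
        r = cut_weight G S / Num.min (vol G S) (vol G (~: S))]].

Definition transition G : V -> V -> R := fun i j => G i j / degree G i.

End WeightedGraph.

Section MarkovChain.
Context (R : realType) (V : finType).
Implicit Types (P : V -> V -> R) (pi : V -> R).

Definition stationary P pi :=
  [/\ forall i, 0 <= pi i,
      \sum_i pi i = 1 &
      forall i, \sum_j pi j * P j i = pi i].

(* Probability that X_1, X_2, ... starts with the sequence s, given X_0 = j. *)
Fixpoint path_prob P (j : V) (s : seq V) : R :=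
  if s is k :: s' then P j k * path_prob P k s' else 1.

(* Probability, given X_0 = j, that the first time t >= 1 with X_t = i is t.
   The tuple w lists X_1, ..., X_t, so X_s is entry s - 1 of w. *)
Definition first_passage_prob P (j i : V) (t : nat) : R :=
  \sum_(w : t.-tuple V | (index i w).+1 == t) path_prob P j w.

(* Extended-real valued; m_jj is the mean first return time to j. *)
Definition mean_first_passage P (j i : V) : \bar R :=
  (\sum_(1 <= t <oo) (t%:R * first_passage_prob P j i t)%:E)%E.

Definition kemeny P pi (j : V) : \bar R :=
  (\sum_i (pi i)%:E * mean_first_passage P j i - 1)%E.

End MarkovChain.

(* Main.v *)
(* No spectral decomposition is needed. Let E be the Dirichlet form of the walk
   and h_i(k) the mean time to reach i from k (0 if k = i). The functions h_i
   satisfy (I - P) h_i = 1 - delta_i / pi_i, so E(f, h_i) = pi(f) - f(i), and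
   the Kemeny constant is sum_i pi_i E(h_i, h_i). Since E(f - h_i, f - h_i) >= 0,
   every family (f_i) of trial functions gives the lower bound
     sum_i pi_i (2 (pi(f_i) - f_i(i)) - E(f_i, f_i)).
   With psi = 1_S - pi(S), take f_i = - c psi(i) psi - b delta_i / pi_i, the
   counterpart of a scalar operator on the line spanned by psi and another one
   on its complement: optimizing c and putting b = (n - 2) / n yields
     K >= v / e + (n - 2)^2 / n + b^2 e / v,  v = pi(psi^2), e = E(psi, psi).
   For S of minimal conductance, v / e >= 1 / (2 phi), and the last term makes
   the inequality strict. *)
Require Import Defs.
From HB Require Import structures.
From mathcomp Require Import all_boot all_order all_algebra.
From mathcomp Require Import all_classical all_reals all_analysis.
From mathcomp Require Import ring lra.
Set Implicit Arguments.
Unset Strict Implicit.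
Unset Printing Implicit Defensive.
Import Order.TTheory GRing.Theory Num.Theory.
Import numFieldNormedType.Exports.
Local Open Scope ring_scope.

(** * First-step decomposition of first passage probabilities *)

Lemma big_tuple_cons (R : nmodType) (V : finType) (t : nat)
    (Q : pred (seq V)) (F : seq V -> R) :
  \sum_(w : t.+1.-tuple V | Q w) F w
  = \sum_k \sum_(w : t.-tuple V | Q (k :: w)) F (k :: w).
Proof.
rewrite pair_big_dep /= (reindex (fun p : V * t.-tuple V => [tuple of p.1 :: p.2])) //=.
exists (fun w : t.+1.-tuple V => (thead w, [tuple of behead w])) => [[k w] _|w _] /=.
  by rewrite theadE; congr pair; apply: val_inj.
by rewrite -tuple_eta.
Qed.

Section FirstPassage.
Context (R : realType) (V : finType) (P : V -> V -> R).

Lemma first_passage_prob0 j i : first_passage_prob P j i 0 = 0.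
Proof. by rewrite /first_passage_prob big_pred0. Qed.

(** Conditioning on X_1: a step to i ends the passage at time 1, hence [t == 0]; otherwise the tail
    is a first passage from X_1. *)
Lemma first_passage_probS j i t :
  first_passage_prob P j i t.+1 =
  (t == 0%N)%:R * P j i + \sum_(k | k != i) P j k * first_passage_prob P k i t.
Proof.
rewrite /first_passage_prob.
rewrite (big_tuple_cons t (fun w => (index i w).+1 == t.+1) (path_prob P j)).
rewrite (bigD1 i) //=; congr (_ + _); last first.
  apply: eq_bigr => k ki; rewrite big_distrr /=; apply: eq_bigl => w.
  by rewrite (negbTE ki) eqSS.
case: t => [|t] /=; last by rewrite mul0r big_pred0 // => w; rewrite eqxx.
rewrite (big_pred1 [tuple]) ?mul1r ?mulr1 // => w.
by rewrite [w]tuple0 /= !eqxx.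
Qed.

End FirstPassage.

(** * Maximum principles and mean first passage times of an irreducible chain *)

Section IrreducibleChain.
Context (R : realType) (V : finType) (P : V -> V -> R).
Hypothesis P_ge0 : forall i j, 0 <= P i j.
Hypothesis P_sum1 : forall i, \sum_j P i j = 1.
Hypothesis P_irr : forall i j, connect [rel u v | 0 < P u v] i j.

(** Applied to transition probabilities here and to edge weights in [cut_weight_gt0]. *)
Lemma closed_full (S : {set V}) (x : V) : x \in S ->
  (forall u v, u \in S -> 0 < P u v -> v \in S) -> forall y, y \in S.
Proof.
move=> xS Scl y; have /connectP[p + ->] := P_irr x y.
elim: p x xS => //= v p IHp x xS /andP[xv]; apply: IHp.
exact: Scl xv.
Qed.

(* The set where f is maximal is closed under transitions, unless it contains i. *)
Lemma maximum_principle (i : V) (f : V -> R) :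
  (forall j, j != i -> f j <= \sum_k P j k * f k) -> forall k, f k <= f i.
Proof.
move=> fsub; have [j _ fmax] := @arg_maxP _ _ _ i xpredT f isT.
suff /eqP -> : f i == f j by move=> k; apply: fmax.
apply/negPn/negP => fij.
suff /(_ i) : forall y, y \in [set k | f k == f j] by rewrite inE (negbTE fij).
apply: (@closed_full _ j); first by rewrite inE.
move=> u v; rewrite !inE => /eqP fu uv.
have ui : u != i by apply: contraNneq fij => <-; rewrite fu.
(* Since f u is the maximum, the nonnegative terms [P u k * (f j - f k)] have sum zero, so every
   successor of u is maximal too. *)
have := fsub u ui; rewrite fu -[X in X <= _]mul1r -(P_sum1 u) mulr_suml => le0.
have eq0 : \sum_k P u k * (f j - f k) = 0.
  apply/le_anti/andP; split.
    by under eq_bigr do rewrite mulrBr; rewrite sumrB subr_le0.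
  by apply: sumr_ge0 => k _; rewrite mulr_ge0 // subr_ge0; apply: fmax.
have /(_ v isT)/eqP : forall k, true -> P u k * (f j - f k) = 0.
  by apply: psumr_eq0P => // k _; rewrite mulr_ge0 // subr_ge0; apply: fmax.
by rewrite mulf_eq0 gt_eqF //= subr_eq0 eq_sym.
Qed.

Lemma harmonic_const (f : V -> R) :
  (forall j, f j = \sum_k P j k * f k) -> forall j k, f j = f k.
Proof.
move=> fh j k; apply/le_anti.
by rewrite !(@maximum_principle _ f) // => l _; rewrite -fh.
Qed.

(** Resetting g to 0 at i turns the killed sum into a full average, so the maximum principle bounds
    the modified function by its value 0 at i; the hypothesis then carries the bound back to g. *)
Lemma killed_maximum_principle (i : V) (g : V -> R) :
  (forall j, g j <= \sum_(k | k != i) P j k * g k) -> forall j, g j <= 0.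
Proof.
move=> gsub.
have E j : \sum_(k | k != i) P j k * g k = \sum_k P j k * (if k == i then 0 else g k).
  by rewrite [RHS](bigD1 i) //= eqxx mulr0 add0r; apply: eq_bigr => k /negbTE ->.
have g'le0 k : (if k == i then 0 else g k) <= 0.
  have := @maximum_principle i (fun k => if k == i then 0 else g k) _ k.
  rewrite eqxx; apply => j ji; rewrite (negbTE ji).
  by rewrite -E gsub.
move=> j; apply: le_trans (gsub j) _; rewrite E.
by apply: sumr_le0 => k _; rewrite mulr_ge0_le0.
Qed.

(* The linear system is square, and its kernel is trivial by the maximum principle. *)
Lemma killed_solution (i : V) :
  exists h : V -> R, forall j, h j = 1 + \sum_(k | k != i) P j k * h k.
Proof.
pose Q := \matrix_(a < #|V|, b < #|V|)
  ((enum_val b != i)%:R * P (enum_val a) (enum_val b)).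
have QE (w : 'cV_#|V|) a : (Q *m w) a 0 =
    \sum_(k | k != i) P (enum_val a) k * w (enum_rank k) 0.
  rewrite mxE (reindex (@enum_rank V)) /=; last first.
    by apply: onW_bij; apply: enum_rank_bij.
  rewrite [RHS]big_mkcond; apply: eq_bigr => k _.
  by rewrite mxE enum_rankK; case: eqP => _; rewrite ?mul1r ?mul0r.
have inj : 1%:M - Q \in unitmx.
  (* Transposing makes a kernel vector a solution of the homogeneous killed equation; the principle
     applies to it and to its opposite. *)
  rewrite -unitmx_tr -row_free_unit; apply: inj_row_free => v.
  rewrite -[v in v *m _]trmxK -trmx_mul => /(congr1 trmx).
  rewrite trmxK trmx0 mulmxBl mul1mx => /eqP; rewrite subr_eq0 => /eqP vQ.
  have vk k : v^T (enum_rank k) 0 = \sum_(l | l != i) P k l * v^T (enum_rank l) 0.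
    by rewrite [in LHS]vQ QE enum_rankK.
  apply: trmx_inj; rewrite trmx0; apply/colP => a; rewrite [RHS]mxE -(enum_valK a).
  apply/le_anti/andP; split.
    apply: (@killed_maximum_principle i (fun k => v^T (enum_rank k) 0)) => k.
    by rewrite [X in X <= _]vk.
  rewrite -oppr_le0.
  apply: (@killed_maximum_principle i (fun k => - v^T (enum_rank k) 0)) => k.
  by rewrite [X in - X <= _]vk -sumrN; under [leRHS]eq_bigr do rewrite mulrN.
pose w := invmx (1%:M - Q) *m const_mx 1 : 'cV_#|V|.
have wE : w = const_mx 1 + Q *m w.
  apply/eqP; rewrite -subr_eq -{1}[w]mul1mx -mulmxBl.
  by rewrite mulmxA mulmxV ?mul1mx.
exists (fun k => w (enum_rank k) 0) => j.
by rewrite [in LHS]wE mxE QE mxE enum_rankK.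
Qed.

Local Notation f := (first_passage_prob P).

Lemma path_prob_ge0 j s : 0 <= path_prob P j s.
Proof. by elim: s j => [|k s IH] j //=; rewrite mulr_ge0. Qed.

Lemma first_passage_prob_ge0 j i t : 0 <= f j i t.
Proof. by apply: sumr_ge0 => w _; apply: path_prob_ge0. Qed.

(* F and s are the partial sums of the probability of hitting i from j and of
   the mean first passage time. *)
Let F i N j := \sum_(0 <= t < N) f j i t.
Let s i N j := \sum_(0 <= t < N) t%:R * f j i t.

(** The truncation at N + 1 keeps the times up to N, so a direct step to i, at time 1, counts only
    if N is nonzero. *)
Lemma passage_by_step i N j :
  F i N.+1 j = (N != 0%N)%:R * P j i + \sum_(k | k != i) P j k * F i N k.
Proof.
rewrite /F big_nat_recl // first_passage_prob0 add0r.
under eq_bigr do rewrite first_passage_probS.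
rewrite big_split /= -mulr_suml; congr (_ * _ + _).
  case: N => [|N]; first by rewrite big_geq.
  by rewrite big_nat_recl // big1 ?addr0.
rewrite exchange_big /=; apply: eq_bigr => k _.
by rewrite mulr_sumr.
Qed.

(** The first step adds one unit of time to each later passage, which produces the extra
    [F i N k]. *)
Lemma truncated_mean_step i N j :
  s i N.+1 j = (N != 0%N)%:R * P j i + \sum_(k | k != i) P j k * (s i N k + F i N k).
Proof.
rewrite /s big_nat_recl // first_passage_prob0 mulr0 add0r.
under eq_bigr do rewrite first_passage_probS mulrDr mulrA.
rewrite big_split /= -mulr_suml; congr (_ * _ + _).
  case: N => [|N]; first by rewrite big_geq.
  by rewrite big_nat_recl // big1 ?addr0 ?mulr1 // => t _; rewrite mulr0.
under eq_bigr do rewrite mulr_sumr.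
rewrite exchange_big /=; apply: eq_bigr => k _.
rewrite /F -big_split /= mulr_sumr; apply: eq_bigr => t _.
by rewrite -natr1; ring.
Qed.

Lemma stochastic_split i j : P j i + \sum_(k | k != i) P j k = 1.
Proof. by rewrite -(P_sum1 j) [RHS](bigD1 i). Qed.

Lemma passage_by_le1 i N j : F i N j <= 1.
Proof.
elim: N j => [|N IH] j; first by rewrite /F big_geq.
rewrite passage_by_step -[leRHS](stochastic_split i j) lerD //.
  by rewrite ler_piMl // lern1 leq_b1.
by apply: ler_sum => k _; rewrite ler_piMr.
Qed.

(** By induction on N, any solution of the killed equation dominates the partial sums, which
    provides the bound needed for convergence. *)
Lemma truncated_mean_le i (h : V -> R) :
  (forall j, h j = 1 + \sum_(k | k != i) P j k * h k) ->
  forall N j, s i N j <= h j.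
Proof.
move=> hE.
have h_ge0 j : 0 <= h j.
  rewrite -oppr_le0; apply: (@killed_maximum_principle i (\- h)) => k.
  under eq_bigr do rewrite mulrN; rewrite sumrN lerN2 [leRHS]hE.
  by rewrite lerDr.
elim=> [|N IH] j; first by rewrite /s big_geq.
rewrite truncated_mean_step [leRHS]hE -[X in _ <= X + _](stochastic_split i j).
rewrite -addrA lerD //.
  by rewrite ler_piMl // lern1 leq_b1.
rewrite -big_split /=; apply: ler_sum => k _.
by rewrite -[X in _ <= X + _]mulr1 -mulrDr addrC ler_wpM2l // lerD // passage_by_le1.
Qed.

Local Open Scope classical_set_scope.
Local Open Scope ring_scope.

Lemma cvg_killed_sum i j (u : nat -> V -> R) (l : V -> R) :
  (forall k, (fun N => u N k) @ \oo --> l k) ->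
  (fun N => \sum_(k | k != i) P j k * u N k) @ \oo -->
  \sum_(k | k != i) P j k * l k.
Proof.
move=> ul; apply: cvg_big => [|k _]; first exact: add_continuous.
by apply: cvgM; [exact: cvg_cst | exact: ul].
Qed.

(** The partial sums are monotone and bounded by a killed solution, so they converge; the limit of
    their recursion is the equation of m. *)
Lemma mean_first_passage_fin (i : V) :
  exists m : V -> R, forall j,
    mean_first_passage P j i = (m j)%:E /\
    m j = 1 + \sum_(k | k != i) P j k * m k.
Proof.
have [h hE] := killed_solution i.
have Fcvg j : cvgn (F i ^~ j).
  apply: nondecreasing_is_cvgn; last by exists 1 => _ [N _ <-]; apply: passage_by_le1.
  apply: (@nondecreasing_series R (f j i) xpredT 0%N).
  by move=> t _ _; apply: first_passage_prob_ge0.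
have scvg j : cvgn (s i ^~ j).
  apply: nondecreasing_is_cvgn; last first.
    by exists (h j) => _ [N _ <-]; apply: truncated_mean_le.
  apply: (@nondecreasing_series R (fun t => t%:R * f j i t) xpredT 0%N) => t _ _.
  by rewrite mulr_ge0 // first_passage_prob_ge0.
pose phi j := limn (F i ^~ j); pose m j := limn (s i ^~ j).
have one_cvg j : (fun N => (N != 0%N)%:R * P j i) @ \oo --> P j i.
  rewrite -(cvg_shiftS (fun N => (N != 0%N)%:R * P j i)) /=.
  under eq_fun do rewrite mul1r; exact: cvg_cst.
have phiE j : phi j = P j i + \sum_(k | k != i) P j k * phi k.
  apply: cvg_lim => //; rewrite -cvg_shiftS /=.
  under eq_fun do rewrite passage_by_step.
  by apply: cvgD; [exact: one_cvg | exact: cvg_killed_sum].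
(* The chain hits i almost surely. *)
have phi1 j : phi j = 1.
  apply/le_anti/andP; split.
    apply: limr_le => //; near=> N; exact: passage_by_le1.
  (* The probability [1 - phi] of never reaching i solves the homogeneous killed equation. *)
  rewrite -subr_le0; apply: (@killed_maximum_principle i (fun j => 1 - phi j)) => k.
  rewrite [in leLHS]phiE -{1}(stochastic_split i k).
  under [leRHS]eq_bigr do rewrite mulrBr mulr1.
  by rewrite sumrB [X in X - _ <= _]addrC addrKA.
have mE j : m j = 1 + \sum_(k | k != i) P j k * m k.
  apply: cvg_lim => //; rewrite -cvg_shiftS /=.
  under eq_fun do rewrite truncated_mean_step.
  rewrite -[X in X + _](stochastic_split i j) -addrA -big_split /=.
  apply: cvgD; first exact: one_cvg.
  under [X in _ --> X]eq_bigr do rewrite -[X in X + _]mulr1 -mulrDr addrC -(phi1 i).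
  apply: (@cvg_killed_sum i j (fun N k => s i N k + F i N k) (fun k => m k + phi i)) => k.
  by apply: cvgD; [exact: scvg | rewrite phi1 -(phi1 k); exact: Fcvg].
exists m => j; split => //.
rewrite /mean_first_passage; apply: cvg_lim => //.
rewrite (_ : (fun n => _) = EFin \o s i ^~ j); last first.
  apply/funext => N /=; rewrite sumEFin /s; congr EFin.
  (* The series starts at t = 1 and [s] at t = 0, where the term vanishes. *)
  case: N => [|N]; first by rewrite !big_geq.
  by rewrite [RHS]big_ltn // mul0r add0r.
by apply: cvg_EFin; [near=> N | exact: scvg].
Unshelve. all: by end_near. Qed.

End IrreducibleChain.

(** * Dirichlet form of a reversible chain and lower bounds for the Kemeny constant *)

Lemma sum_indicator (R : nzRingType) (V : finType) (F : V -> R) (i : V) :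
  \sum_k F k * (k == i)%:R = F i.
Proof.
by rewrite (bigD1 i) //= big1 ?eqxx ?mulr1 ?addr0 // => k /negbTE ->; rewrite mulr0.
Qed.

Section ReversibleChain.
Context (R : realType) (V : finType) (P : V -> V -> R) (pi : V -> R).
Hypothesis P_ge0 : forall i j, 0 <= P i j.
Hypothesis P_sum1 : forall i, \sum_j P i j = 1.
Hypothesis P_irr : forall i j, connect [rel u v | 0 < P u v] i j.
Hypothesis pi_gt0 : forall i, 0 < pi i.
Hypothesis pi_sum1 : \sum_i pi i = 1.
Hypothesis pi_rev : forall i j, pi i * P i j = pi j * P j i.

Definition dirichlet (f g : V -> R) : R :=
  2^-1 * \sum_i \sum_j pi i * P i j * ((f i - f j) * (g i - g j)).

(** Green's formula: by reversibility, exchanging i and j turns the [f j] half of the double sum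
    into minus the [f i] half, which absorbs the factor 1/2. *)
Lemma dirichletE f g :
  dirichlet f g = \sum_i pi i * f i * (g i - \sum_j P i j * g j).
Proof.
have E : \sum_i \sum_j pi i * P i j * (f i * (g i - g j)) =
    \sum_i pi i * f i * (g i - \sum_j P i j * g j).
  apply: eq_bigr => i _; rewrite -[X in _ * (X - _)]mul1r -(P_sum1 i).
  rewrite mulr_suml -sumrB mulr_sumr; apply: eq_bigr => j _; ring.
have E' : \sum_i \sum_j pi i * P i j * (f j * (g i - g j)) =
    - \sum_i \sum_j pi i * P i j * (f i * (g i - g j)).
  rewrite exchange_big /= -sumrN; apply: eq_bigr => i _.
  by rewrite -sumrN; apply: eq_bigr => j _; rewrite pi_rev; ring.
rewrite /dirichlet -E.
transitivity (2^-1 * (\sum_i \sum_j pi i * P i j * (f i * (g i - g j)) -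
                      \sum_i \sum_j pi i * P i j * (f j * (g i - g j)))).
  congr (_ * _); rewrite -sumrB; apply: eq_bigr => i _.
  by rewrite -sumrB; apply: eq_bigr => j _; ring.
by rewrite E'; field.
Qed.

Lemma dirichlet_ge0 f : 0 <= dirichlet f f.
Proof.
rewrite mulr_ge0 ?invr_ge0 ?ler0n // !sumr_ge0 // => i _; apply: sumr_ge0 => j _.
by rewrite -expr2 mulr_ge0 ?sqr_ge0 // mulr_ge0 // ltW.
Qed.

Lemma dirichlet_sqrD (a b : R) f g :
  dirichlet (fun k => a * f k + b * g k) (fun k => a * f k + b * g k) =
  a ^+ 2 * dirichlet f f + 2 * a * b * dirichlet f g + b ^+ 2 * dirichlet g g.
Proof.
rewrite /dirichlet !(mulrCA _ 2^-1) -!mulrDr; congr (_ * _).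
rewrite !mulr_sumr -!big_split /=; apply: eq_bigr => i _.
rewrite !mulr_sumr -!big_split /=; apply: eq_bigr => j _; ring.
Qed.

Lemma dirichlet_delta i g :
  dirichlet (fun k => (k == i)%:R) g = pi i * (g i - \sum_j P i j * g j).
Proof.
by rewrite dirichletE; under eq_bigr do rewrite mulrAC; rewrite sum_indicator.
Qed.

Lemma kemeny_dirichlet j : exists h : V -> V -> R,
  kemeny P pi j = (\sum_i pi i * dirichlet (h i) (h i))%:E /\
  forall i f, dirichlet f (h i) = \sum_k pi k * f k - f i.
Proof.
have /choice[m mP] := mean_first_passage_fin P_ge0 P_sum1 P_irr.
pose h i k := if k == i then 0 else m i k.
have mE i k : m i k = 1 + \sum_l P k l * h i l.
  rewrite (mP i k).2 [in RHS](bigD1 i) //= /h eqxx mulr0 add0r.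
  by congr (_ + _); apply: eq_bigr => l /negbTE ->.
have stat g : \sum_k pi k * \sum_l P k l * g l = \sum_l pi l * g l.
  under eq_bigr do rewrite mulr_sumr.
  rewrite exchange_big /=; apply: eq_bigr => l _.
  under eq_bigr do rewrite mulrA pi_rev -mulrA (mulrC (P _ _)) mulrA.
  by rewrite -mulr_sumr P_sum1 mulr1.
have hm i k : h i k = m i k - m i i * (k == i)%:R.
  by rewrite /h; case: eqP => [->|_]; rewrite ?mulr1 ?subrr // mulr0 subr0.
(* Kac's formula: P h_i = m_i - 1 and h_i = m_i - m_ii delta_i have the same mean under pi. *)
have return_time i : pi i * m i i = 1.
  have := stat (h i); under eq_bigr => k _.
    rewrite (_ : \sum_l P k l * h i l = m i k - 1) ?mulrBr ?mulr1; last first.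
      by rewrite mE addrC addKr.
    over.
  rewrite sumrB pi_sum1; under [RHS]eq_bigr do rewrite hm mulrBr mulrA.
  by rewrite [RHS]sumrB sum_indicator => /addrI/oppr_inj.
have laplace i k : h i k - \sum_l P k l * h i l = 1 - (k == i)%:R / pi i.
  have -> : \sum_l P k l * h i l = m i k - 1 by rewrite mE addrC addKr.
  have -> : (pi i)^-1 = m i i.
    by apply: (mulfI (lt0r_neq0 (pi_gt0 i))); rewrite return_time divff // gt_eqF.
  by rewrite hm; ring.
have hE i f : dirichlet f (h i) = \sum_k pi k * f k - f i.
  rewrite dirichletE; under eq_bigr do rewrite laplace mulrBr mulr1 mulrA mulrAC.
  by rewrite sumrB sum_indicator; field; rewrite gt_eqF.
exists h; split => //.
(* kappa is harmonic, so that the Kemeny constant does not depend on j. *)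
pose kappa k := \sum_i pi i * h i k.
have kappa_const k : kappa k = kappa j.
  apply: (harmonic_const P_ge0 P_sum1 P_irr) => {}k.
  apply/eqP; rewrite -subr_eq0; apply/eqP; rewrite /kappa.
  under [X in _ - X]eq_bigr do rewrite mulr_sumr.
  rewrite exchange_big /= -sumrB.
  transitivity (\sum_i (pi i - (k == i)%:R)).
    apply: eq_bigr => i _; under eq_bigr do rewrite mulrCA.
    rewrite -mulr_sumr -mulrBr laplace.
    by field; rewrite gt_eqF.
  rewrite sumrB pi_sum1; under eq_bigr do rewrite eq_sym -[_%:R]mul1r.
  by rewrite sum_indicator subrr.
rewrite /kemeny; under eq_bigr => i _ do rewrite (mP i j).1 -EFinM.
rewrite sumEFin -EFinB; congr EFin; transitivity (kappa j).
  (* The 1 subtracted in [kemeny] is the return term [pi j * m j j]. *)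
  rewrite /kappa -(return_time j) (bigD1 j) //= addrAC subrr add0r.
  rewrite [RHS](bigD1 j) //= [h j j]/h eqxx mulr0 add0r.
  by apply: eq_bigr => i /negbTE ij; rewrite /h eq_sym ij.
(* The constant kappa equals its average under pi; after exchanging sums, the mean of [h i] is its
   energy, by [hE] and h_i(i) = 0. *)
rewrite -[LHS]mul1r -pi_sum1 mulr_suml.
under eq_bigr => k _ do rewrite -(kappa_const k) mulr_sumr.
rewrite exchange_big /=; apply: eq_bigr => i _.
rewrite hE [h i i]/h eqxx subr0 mulr_sumr.
by apply: eq_bigr => k _; rewrite mulrCA.
Qed.

(** The parameters b and c stay free until [kemeny_gt_cut]. The zero diagonal gives delta_i the
    energy [pi i], whence the term b^2 n. *)
Lemma kemeny_lower_bound (P0 : forall i, P i i = 0) (psi : V -> R)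
    (psi0 : \sum_i pi i * psi i = 0) (b c : R) (j : V) :
  ((2 * (c * (\sum_i pi i * psi i ^+ 2) + b * (#|V|%:R - 1))
    - (c ^+ 2 * (\sum_i pi i * psi i ^+ 2) * dirichlet psi psi
       + 2 * b * c * dirichlet psi psi + b ^+ 2 * #|V|%:R))%:E
   <= kemeny P pi j)%E.
Proof.
set v := \sum_i _; set e := dirichlet _ _.
have [h [-> hE]] := kemeny_dirichlet j; rewrite lee_fin.
have dual i (f : V -> R) :
    2 * (\sum_k pi k * f k - f i) - dirichlet f f <= dirichlet (h i) (h i).
  have := dirichlet_ge0 (fun k => 1 * f k + -1 * h i k).
  rewrite dirichlet_sqrD hE; lra.
pose f i k := - (c * psi i) * psi k + - (b / pi i) * (k == i)%:R.
(* The factor [(pi i)^-1] will cancel the weight in the sum over i; the cross terms then add up to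
   [e] by [dirichletE]. *)
have fE i : 2 * (\sum_k pi k * f i k - f i i) - dirichlet (f i) (f i) =
    (pi i)^-1 * (2 * (c * (pi i * psi i ^+ 2) + b * (1 - pi i))
    - (c ^+ 2 * (pi i * psi i ^+ 2) * e
       + 2 * b * c * (pi i * psi i * (psi i - \sum_k P i k * psi k)) + b ^+ 2)).
  have -> : \sum_k pi k * f i k = - b.
    transitivity (- (c * psi i) * (\sum_k pi k * psi k)
        - b / pi i * \sum_k pi k * (k == i)%:R).
      by rewrite !mulr_sumr -sumrB; apply: eq_bigr => k _; rewrite /f; ring.
    by rewrite psi0 sum_indicator; field; rewrite gt_eqF.
  have dC : dirichlet psi (fun k => (k == i)%:R) = dirichlet (fun k => (k == i)%:R) psi.
    congr (_ * _); apply: eq_bigr => k _; apply: eq_bigr => l _.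
    by rewrite [_ * (psi _ - _)]mulrC.
  rewrite dirichlet_sqrD dC !dirichlet_delta /f eqxx sum_indicator P0.
  by rewrite -/e mulr1n; field; rewrite gt_eqF.
apply: (@le_trans _ _ (\sum_i pi i *
    (2 * (\sum_k pi k * f i k - f i i) - dirichlet (f i) (f i)))); last first.
  by apply: ler_sum => i _; rewrite ler_wpM2l // ltW.
rewrite le_eqVlt; apply/orP; left; apply/eqP.
under [RHS]eq_bigr => i _ do rewrite fE mulVKf ?gt_eqF //.
have eE : \sum_i pi i * psi i * (psi i - \sum_k P i k * psi k) = e.
  by rewrite /e dirichletE.
have nE : \sum_(i : V) (1 : R) = #|V|%:R by rewrite sumr_const.
rewrite sumrB -mulr_sumr !big_split /= -!mulr_sumr -mulr_suml -!mulr_sumr sumrB.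
rewrite eE pi_sum1 nE -/v sumr_const; ring.
Qed.

End ReversibleChain.

(** * Random walk on a connected weighted graph, cuts and conductance *)

Section ConnectedGraph.
Context (R : realType) (V : finType) (G : wgraph R V).
Hypothesis V_gt1 : (1 < #|V|)%N.
Hypothesis G_connected : connected_graph G.

Lemma degree_gt0 i : 0 < degree G i.
Proof.
have [j ji] : exists j, j != i.
  have /card_gt1P[a [b [_ _ ab]]] := V_gt1.
  by case: (eqVneq a i) ab => [-> ib|]; [exists b; rewrite eq_sym | exists a].
have /connectP[[|k p] /=] := G_connected i j; first by move=> _ /eqP; rewrite (negbTE ji).
case/andP=> ik _ _; apply: lt_le_trans ik _.
by rewrite /degree (bigD1 k) //= lerDl sumr_ge0 // => l _; apply: weight_ge0.
Qed.

Lemma transition_ge0 i j : 0 <= transition G i j.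
Proof. by rewrite divr_ge0 ?weight_ge0 // ltW ?degree_gt0. Qed.

Lemma transition_sum1 i : \sum_j transition G i j = 1.
Proof. by rewrite -mulr_suml divff // gt_eqF ?degree_gt0. Qed.

Lemma transition_irr i j : connect [rel u v | 0 < transition G u v] i j.
Proof.
rewrite (eq_connect (e' := edge G)) ?G_connected // => u v /=.
by rewrite /transition pmulr_lgt0 // invr_gt0 degree_gt0.
Qed.

Lemma vol_gt0 (S : {set V}) : S != finset.set0 -> 0 < vol G S.
Proof.
case/set0Pn => i iS; rewrite /vol (bigD1 i) //= ltr_pwDl ?degree_gt0 //.
by apply: sumr_ge0 => k _; rewrite ltW ?degree_gt0.
Qed.

Lemma setC_neq0 (S : {set V}) : S \proper finset.setT -> ~: S != finset.set0.
Proof.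
by move=> /properP[_ [x _ xS]]; apply/set0Pn; exists x; rewrite inE.
Qed.

Lemma volC (S : {set V}) : vol G S + vol G (~: S) = vol G finset.setT.
Proof.
rewrite /vol [RHS](big_setID S) /=; congr (_ + _);
  by apply: eq_bigl => i; rewrite !inE ?andbT.
Qed.

Lemma setT_neq0 : finset.setT != finset.set0 :> {set V}.
Proof. by rewrite -card_gt0 cardsT ltnW. Qed.

Lemma stationaryE pi i : stationary (transition G) pi ->
  pi i = degree G i / vol G finset.setT.
Proof.
case=> _ pi_sum1 pi_stat.
have dn0 k : degree G k != 0 by rewrite gt_eqF ?degree_gt0.
(* By the symmetry of the weights, pi / degree is harmonic. *)
have x_const k : pi k / degree G k = pi i / degree G i.
  apply: (harmonic_const transition_ge0 transition_sum1 transition_irr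
    (f := fun k => pi k / degree G k)) => {}k.
  rewrite -[in LHS](pi_stat k) mulr_suml; apply: eq_bigr => l _.
  by rewrite /transition weight_sym; field; rewrite !dn0.
have piE k : pi k = pi i / degree G i * degree G k by rewrite -(x_const k) divfK.
have : pi i / degree G i * vol G finset.setT = 1.
  rewrite /vol mulr_sumr -pi_sum1; apply: eq_big => [k|k _]; first by rewrite inE.
  by rewrite -piE.
have volT := vol_gt0 setT_neq0 => e.
rewrite -[LHS](divfK (dn0 i)) -[X in X * _ = _](mulfK (lt0r_neq0 volT)) e mul1r.
by rewrite mulrC.
Qed.

(** If no weight crossed the cut, S would be closed along edges, hence all of V. *)
Lemma cut_weight_gt0 (S : {set V}) :
  S != finset.set0 -> S \proper finset.setT -> 0 < cut_weight G S.
Proof.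
case/set0Pn => x xS; rewrite properE => /andP[_ /subsetPn[y _ yS]].
rewrite lt_neqAle eq_sym andbC.
have cut_ge0 u : 0 <= \sum_(v in ~: S) G u v.
  by apply: sumr_ge0 => v _; apply: weight_ge0.
rewrite sumr_ge0 //=; apply/negP => /eqP cut0.
case/negP: yS; apply: (closed_full (P := G) G_connected xS) => u v uS uv.
apply/negPn/negP => vS.
have /(_ u uS) := psumr_eq0P (fun u _ => cut_ge0 u) cut0.
have wge0 w : w \in ~: S -> 0 <= G u w by move=> _; apply: weight_ge0.
move/(psumr_eq0P wge0)/(_ v); rewrite inE => /(_ vS) uv0.
by move: uv; rewrite uv0 ltxx.
Qed.

(** The right side counts each crossing pair in both orders; up to normalization it is the Dirichlet
    energy of the indicator of S. *)
Lemma cut_weightE (S : {set V}) :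
  2 * cut_weight G S = \sum_i \sum_j G i j * ((i \in S)%:R - (j \in S)%:R) ^+ 2.
Proof.
have cutE : cut_weight G S = \sum_i \sum_j G i j * ((i \in S)%:R * (j \notin S)%:R).
  rewrite /cut_weight big_mkcond; apply: eq_bigr => i _.
  case: ifP => _; last by rewrite big1 // => j _; rewrite mul0r mulr0.
  rewrite big_mkcond; apply: eq_bigr => j _; rewrite inE mul1r.
  by case: (j \in S); rewrite ?mulr0 ?mulr1.
have cutE' : cut_weight G S = \sum_i \sum_j G i j * ((j \in S)%:R * (i \notin S)%:R).
  rewrite cutE exchange_big /=; apply: eq_bigr => i _; apply: eq_bigr => j _.
  by rewrite weight_sym.
rewrite mulr_natl mulr2n {1}cutE cutE' -big_split /=; apply: eq_bigr => i _.
rewrite -big_split /=; apply: eq_bigr => j _.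
by case: (i \in S); case: (j \in S) => /=; ring.
Qed.

(** The fraction of volumes is v / e for psi = 1_S - pi(S): v = s (1 - s) with s = pi(S), and e is
    the cut weight over the total volume. *)
Lemma kemeny_gt_cut (pi : V -> R) (j : V) (S : {set V}) :
  (2 < #|V|)%N -> stationary (transition G) pi ->
  S != finset.set0 -> S \proper finset.setT ->
  ((vol G S * vol G (~: S) / (vol G finset.setT * cut_weight G S)
    + (#|V|%:R - 2) ^+ 2 / #|V|%:R)%:E < kemeny (transition G) pi j)%E.
Proof.
move=> V_gt2 pi_stat S0 ST.
have volT := vol_gt0 setT_neq0; have volS := vol_gt0 S0.
have volSC := vol_gt0 (setC_neq0 ST).
have cut_gt0 := cut_weight_gt0 S0 ST.
have piE i := stationaryE i pi_stat.
have pi_gt0 i : 0 < pi i by rewrite piE divr_gt0 ?degree_gt0.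
have piP k l : pi k * transition G k l = G k l / vol G finset.setT.
  by rewrite piE /transition; field; rewrite !gt_eqF ?degree_gt0.
have pi_rev k l : pi k * transition G k l = pi l * transition G l k.
  by rewrite !piP weight_sym.
have [_ pi_sum1 _] := pi_stat.
have loopless i : transition G i i = 0 by rewrite /transition weight_loopless mul0r.
pose s := vol G S / vol G finset.setT.
have pi_S : \sum_i pi i * (i \in S)%:R = s.
  rewrite /s /vol mulr_suml [RHS]big_mkcond; apply: eq_bigr => i _.
  by rewrite piE; case: (i \in S); rewrite ?mulr1 ?mulr0.
pose psi i : R := (i \in S)%:R - s.
have psi0 : \sum_i pi i * psi i = 0.
  under eq_bigr do rewrite mulrBr.
  by rewrite sumrB pi_S -mulr_suml pi_sum1 mul1r subrr.
have vE : \sum_i pi i * psi i ^+ 2 = s * (1 - s).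
  transitivity (\sum_i (pi i * (i \in S)%:R * (1 - 2 * s) + pi i * s ^+ 2)).
    by apply: eq_bigr => i _; rewrite /psi; case: (i \in S) => /=; ring.
  by rewrite big_split /= -!mulr_suml pi_S pi_sum1; ring.
have eE : dirichlet (transition G) pi psi psi = cut_weight G S / vol G finset.setT.
  rewrite /dirichlet; apply: (mulfI (lt0r_neq0 (ltr0n R 2))).
  rewrite mulVKf ?pnatr_eq0 // mulrA cut_weightE mulr_suml; apply: eq_bigr => k _.
  rewrite mulr_suml; apply: eq_bigr => l _.
  by rewrite piP /psi; ring.
have s1 : 1 - s = vol G (~: S) / vol G finset.setT.
  by rewrite /s -(volC S); field; rewrite volC gt_eqF.
have v_gt0 : 0 < s * (1 - s) by rewrite s1 mulr_gt0 // divr_gt0.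
have e_gt0 : 0 < cut_weight G S / vol G finset.setT by rewrite divr_gt0.
(* Once c is optimized, b contributes 2 (n - 2) b - n b^2 besides b^2 e / v; this b maximizes that
   quadratic, with value (n - 2)^2 / n. *)
pose n : R := #|V|%:R; pose b := (n - 2) / n.
have n_gt2 : 2 < n by rewrite ltr_nat.
have n_gt0 : 0 < n by lra.
have b_gt0 : 0 < b by rewrite divr_gt0 // subr_gt0.
move: v_gt0 e_gt0 vE eE.
have -> : vol G S * vol G (~: S) / (vol G finset.setT * cut_weight G S) =
    s * (1 - s) / (cut_weight G S / vol G finset.setT).
  by rewrite s1 /s; field; rewrite !gt_eqF.
move: (s * (1 - s)) (cut_weight G S / _) => v e v_gt0 e_gt0 vE eE.
(* For fixed b, the bound is a concave quadratic in c, maximal at c = 1 / e - b / v. *)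
have := kemeny_lower_bound transition_ge0 transition_sum1 transition_irr pi_gt0
  pi_sum1 pi_rev loopless psi0 b ((v / e - b) / v) j.
rewrite vE eE -/n; apply: lt_le_trans; rewrite lte_fin -subr_gt0.
rewrite [ltRHS](_ : _ = b ^+ 2 * e / v).
  by rewrite divr_gt0 // mulr_gt0 // exprn_gt0.
by rewrite /b; field; rewrite !gt_eqF.
Qed.

(** There are finitely many cuts, and a singleton is one because V has two vertices, so a minimizer
    exists and realizes [inf]. *)
Lemma conductance_attained : exists S : {set V},
  [/\ S != finset.set0, S \proper finset.setT &
      conductance G = cut_weight G S / Num.min (vol G S) (vol G (~: S))].
Proof.
have /card_gt0P[x _] : (0 < #|V|)%N by apply: ltnW.
pose Q (S : {set V}) := (S != finset.set0) && (S \proper finset.setT).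
have Qx : Q [set x]%SET.
  rewrite /Q -card_gt0 cards1 properEcard finset.subsetT cards1 cardsT /=.
  exact: V_gt1.
pose F (S : {set V}) := cut_weight G S / Num.min (vol G S) (vol G (~: S)).
have [S /andP[S0 ST] Smin] := arg_minP F Qx.
exists S; split => //; apply/le_anti/andP; split.
  apply: ge_inf; last by exists S.
  by exists (F S) => _ [T [T0 TT ->]]; apply: Smin; rewrite /Q T0.
apply: lb_le_inf; first by exists (F S), S.
by move=> _ [T [T0 TT ->]]; apply: Smin; rewrite /Q T0.
Qed.

End ConnectedGraph.

Theorem corollary4p8 (R : realType) (V : finType) (G : wgraph R V)
    (hn : (3 <= #|V|)%N) (hG : connected_graph G)
    (pi : V -> R) (hpi : stationary (transition G) pi) (j : V) :
  let K := kemeny (transition G) pi j in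
  let bound := (2 * conductance G)^-1 + (#|V|%:R - 2) ^+ 2 / #|V|%:R in
  (bound%:E <= K)%E /\ K <> bound%:E.
Proof.
move=> K bound; suff lt : (bound%:E < K)%E.
  by split; [exact: ltW | apply/eqP; rewrite gt_eqF].
have V_gt1 := ltnW hn.
have [S [S0 ST phiE]] := conductance_attained G V_gt1.
apply: le_lt_trans (kemeny_gt_cut V_gt1 hG j hn hpi S0 ST).
rewrite lee_fin lerD2r phiE -(volC G S).
have volS := vol_gt0 V_gt1 hG S0.
have volSC := vol_gt0 V_gt1 hG (setC_neq0 ST).
have cut_gt0 := cut_weight_gt0 hG S0 ST.
move: (vol G S) (vol G (~: S)) (cut_weight G S) volS volSC cut_gt0 => x y c x0 y0 c0.
have min_gt0 : 0 < Num.min x y by rewrite lt_min x0.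
have -> : (2 * (c / Num.min x y))^-1 = Num.min x y / (2 * c).
  by field; rewrite !gt_eqF.
rewrite ler_pdivrMr ?mulr_gt0 // mulrAC ler_pdivlMr ?mulr_gt0 ?addr_gt0 //.
(* The claim amounts to x + y <= 2 max(x, y); after clearing denominators the slack is min(x, y) c
   |x - y|. *)
have [xy|/ltW yx] := leP x y.
  have : 0 <= x * c * (y - x) by rewrite mulr_ge0 ?subr_ge0 // mulr_ge0 // ltW.
  lra.
have : 0 <= y * c * (x - y) by rewrite mulr_ge0 ?subr_ge0 // mulr_ge0 // ltW.
lra.
Qed.
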